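(* Let $K:\mathcal{D}\to[0,\infty)$ be a map and let $\sigma_i$, $i=1,\ldots,n$, be positive Borel measures on $\mathbb{R}^d$. Let $1<p_i<\infty$ for $i=1,\ldots,n$ and suppose $\sum_{i=1}^n\frac1{p_i}\ge 1$. The following statements are equivalent: (a) The $n$ linear embedding theorem holds: there is a finite constant $c_1$ such that for all $f_i\in L^{p_i}(d\sigma_i)$, $i=1,\ldots,n$, $$\sum_{Q\in\mathcal{D}}K(Q)\prod_{i=1}^n\left|\int_{Q}f_i\,d\sigma_i\right|\le c_1\prod_{i=1}^n\|f_i\|_{L^{p_i}(d\sigma_i)}<\infty;$$ (b) There is a finite constant $c_2$ such that for all $j=1,\ldots,n$, for all $Q\in\mathcal{D}$ and for all $f_i\in L^{p_i}(d\sigma_i)$, $i\in\{1,\ldots,n\}\setminus\{j\}$, $$\sum_{Q'\subset Q}K(Q')\,\sigma_j(Q')\prod_{\substack{i=1\\ i\ne j}}^n\left|\int_{Q'}f_i\,d\sigma_i\right|\le c_2\,\sigma_j(Q)^{1/p_j}\prod_{\substack{i=1\\ i\ne j}}^n\|f_i\|_{L^{p_i}(d\sigma_i)}<\infty.$$ Moreover, the least possible $c_1$ and $c_2$ are equivalent.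
   Context: $\mathcal{D}$ denotes the family of all dyadic cubes $Q=2^{-k}(m+[0,1)^d)$, $k\in\mathbb{Z}$, $m\in\mathbb{Z}^d$, in $\mathbb{R}^d$. The sum $\sum_{Q'\subset Q}$ runs over all $Q'\in\mathcal{D}$ with $Q'\subset Q$ (including $Q'=Q$). That the least possible constants $c_1$ and $c_2$ are equivalent means that each is bounded by a constant multiple of the other, the multiplicative constants being independent of $K$ and of the measures $\sigma_i$.
   Formalization: The positive Borel measures σ_i are additionally assumed finite on every dyadic cube; without this the integrals of L^{p_i} functions over cubes may be undefined and the equivalence of (a) and (b) fails. *)

(* Defs.v *)
From HB Require Import structures.
From mathcomp Require Import all_boot all_order all_algebra.
From mathcomp Require Import all_classical all_reals all_analysis.
Import Order.TTheory GRing.Theory Num.Theory.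
Import numFieldNormedType.Exports.

Set Implicit Arguments.
Unset Strict Implicit.
Unset Printing Implicit Defensive.

Local Open Scope classical_set_scope.
Local Open Scope ring_scope.

Definition borelRd (R : realType) (d : nat) :=
  g_sigma_algebraType (@open 'rV[R]_d).

(* 2^-k (m + [0,1)^d) *)
Definition dyadic_cube (R : realType) (d : nat) (k : int) (m : 'rV[int]_d)
    : set (borelRd R d) :=
  [set x : 'rV[R]_d | forall i : 'I_d,
     2 ^ (- k) * (m ord0 i)%:~R <= x ord0 i < 2 ^ (- k) * ((m ord0 i)%:~R + 1)].

(* The family is a set of subsets of R^d, so that a cube is counted once in a
   sum over the family. *)
Definition dyadic_cubes (R : realType) (d : nat) : set (set (borelRd R d)) :=
  [set Q | exists (k : int) (m : 'rV[int]_d), Q = @dyadic_cube R d k m].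

Definition embedding_bound (R : realType) (d n : nat)
    (K : set (borelRd R d) -> R)
    (sigma : 'I_n -> {measure set (borelRd R d) -> \bar R})
    (p : 'I_n -> R) (c : R) : Prop :=
  forall f : 'I_n -> borelRd R d -> R,
    (forall i, f i \in Lfun (sigma i) (p i)%:E) ->
  (\esum_(Q in @dyadic_cubes R d)
      ((K Q)%:E * \prod_(i < n) `|\int[sigma i]_(x in Q) (f i x)%:E|)
   <= c%:E * \prod_(i < n) 'N[sigma i]_((p i)%:E)[EFin \o f i] < +oo)%E.

(* The component f j is unconstrained and does not occur in the inequality. *)
Definition testing_bound (R : realType) (d n : nat)
    (K : set (borelRd R d) -> R)
    (sigma : 'I_n -> {measure set (borelRd R d) -> \bar R})
    (p : 'I_n -> R) (c : R) : Prop :=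
  forall (j : 'I_n) (Q : set (borelRd R d)), @dyadic_cubes R d Q ->
  forall f : 'I_n -> borelRd R d -> R,
    (forall i, i != j -> f i \in Lfun (sigma i) (p i)%:E) ->
  (\esum_(Q' in [set Q' | @dyadic_cubes R d Q' /\ Q' `<=` Q])
      ((K Q')%:E * sigma j Q' *
       \prod_(i < n | i != j) `|\int[sigma i]_(x in Q') (f i x)%:E|)
   <= c%:E * (sigma j Q) `^ (p j)^-1 *
      \prod_(i < n | i != j) 'N[sigma i]_((p i)%:E)[EFin \o f i] < +oo)%E.

(* c ranges over nonnegative constants: when all products of norms vanish,
   negative ones would be admissible too. *)
Definition least_constant (R : realType) (bound : R -> Prop) : \bar R :=
  ereal_inf [set c%:E | c in [set c : R | 0 <= c /\ bound c]].

(* Main.v *)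
Require Import Defs.
From HB Require Import structures.
From mathcomp Require Import all_boot all_order all_algebra.
From mathcomp Require Import all_classical all_reals all_analysis.
From mathcomp Require Import finmap measurable_realfun.
From mathcomp Require Import ring lra.
Import Order.TTheory GRing.Theory Num.Theory.
Import numFieldNormedType.Exports.

(** The testing inequality follows from the embedding by taking f_j = 1_Q, whose
    L^p_j norm is sigma_j(Q)^(1/p_j); the constant does not change
    ([testing_of_embedding]).

    For the converse ([embedding_of_testing]) a sum over all cubes is a supremum
    of finite sums, so it suffices to treat finitely many cubes, with a constant
    that does not depend on their number; the f_i may be replaced by |f_i|, and
    the cubes on which one of the integrals vanishes may be dropped. From then
    on only the fact that two cubes are nested or disjoint matters
    ([finite_embedding]).

    Let a_i(q) be the sigma_i-average of f_i on q and l_i(q) the integer part of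
    ln a_i(q). Among the cubes that contain q, those where l_i is largest have a
    largest member pi_i(q), the principal ancestor of q for f_i. Then
    a_i(q) <= e a_i(pi_i(q)), and along a chain of principal cubes the levels
    l_i are strictly monotone, so that, up to a factor e, the averages grow at
    least geometrically. This yields the Carleson embedding
    ([carleson_embedding]): the sum of a_i(F)^p_i sigma_i(F) over the principal
    cubes F of f_i is at most a constant times the p_i-th power of the norm of
    f_i.

    The cubes pi_1(q), ..., pi_n(q) all contain q, hence form a chain. Sort the
    cubes q by an index j for which pi_j(q) is the largest of them, and by
    F = pi_j(q). For such q the function f_j can be replaced by e times its
    average on F. For i <> j the cube G = pi_i(q) lies between q and F, so
    pi_j(G) = F, and f_i can be replaced by e times a single function h_i (a
    [packet]) that dominates a_i(G) on each principal cube G of f_i with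
    pi_j(G) = F. The testing inequality on F, applied to the h_i, bounds the
    contribution of (j, F) by a constant times the product over i of b_i(F),
    where b_i(F)^p_i is the sum of a_i(G)^p_i sigma_i(G) over the principal G of
    f_i with pi_j(G) = F. Every G belongs to one F only, so by the Carleson
    embedding the sum over F of b_i(F)^p_i is controlled, and since the 1/p_i
    add up to at least 1, Hoelder's inequality for sequences
    ([sum_prod_le]) sums the products over F. *)

Local Open Scope classical_set_scope.
Local Open Scope ring_scope.

Set Implicit Arguments.
Unset Strict Implicit.

(** * Inequalities for finite sums *)

Lemma sum_ge1_gt0 (R : realType) (n : nat) (x : 'I_n -> R) :
  1 <= \sum_(i < n) x i -> (0 < n)%N.
Proof.
move=> x1; rewrite lt0n; apply/eqP => n0; move: x1; rewrite big1 ?ler10// => i.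
by have := ltn_ord i; rewrite {2}n0.
Qed.

(** Distinct exponents make the sum a part of the full geometric series. *)
Lemma sum_expr_inj_le (R : realType) (I : finType) (P : pred I) (k : I -> nat)
    (q : R) :
  0 <= q < 1 -> {in P &, injective k} ->
  \sum_(i | P i) q ^+ k i <= (1 - q)^-1.
Proof.
move=> /andP[q0 q1] kinj.
pose s := [seq k i | i <- enum P].
pose N := (\max_i k i).+1.
have sN : {subset s <= iota 0 N}.
  move=> j /mapP[i _ ->]; rewrite mem_iota /= add0n ltnS.
  exact: leq_bigmax.
have us : uniq s.
  rewrite map_inj_in_uniq ?enum_uniq// => i j.
  by rewrite !mem_enum => Pi Pj; exact: kinj.
have -> : \sum_(i | P i) q ^+ k i = \sum_(j <- s) q ^+ j.
  by rewrite big_map big_enum.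
have -> : \sum_(j <- s) q ^+ j = \sum_(j <- iota 0 N | j \in s) q ^+ j.
  rewrite -[RHS]big_filter; apply: perm_big; apply: uniq_perm => //.
    by rewrite filter_uniq ?iota_uniq.
  by move=> j; rewrite mem_filter; case: (boolP (j \in s)) => //= /sN.
have le1 : \sum_(j <- iota 0 N | j \in s) q ^+ j <= \sum_(j < N) q ^+ j.
  rewrite -(big_mkord xpredT (fun j => q ^+ j)) /index_iota subn0.
  rewrite [leLHS]big_mkcond; apply: ler_sum => j _.
  by case: ifP => // _; rewrite exprn_ge0.
apply: (le_trans le1).
rewrite -[leRHS]mul1r ler_pdivlMr ?subr_gt0//.
have := subrX1 q N; have := exprn_ge0 N q0; nra.
Qed.

(** Distinct integer levels below ln y: the sum is dominated, up to a constant,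
    by its largest possible term. *)
Lemma sum_expR_levels_le (R : realType) (I : finType) (P : pred I)
    (l : I -> int) (t y : R) :
  0 < t -> 0 < y -> {in P &, injective l} ->
  (forall i, P i -> expR (l i)%:~R <= y) ->
  \sum_(i | P i) expR ((l i)%:~R * t) <= y `^ t / (1 - expR (- t)).
Proof.
move=> t0 y0 linj ly.
pose m := Num.floor (ln y).
have lm i : P i -> l i <= m.
  move=> Pi; rewrite /m floor_ge_int -ler_expR lnK ?posrE//; exact: ly.
have q1 : 0 <= expR (- t) < 1 by rewrite expR_ge0 expR_lt1 oppr_lt0.
have -> : \sum_(i | P i) expR ((l i)%:~R * t) =
    expR (m%:~R * t) * \sum_(i | P i) expR (- t) ^+ `|m - l i|%N.
  rewrite mulr_sumr; apply: eq_bigr => i Pi.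
  rewrite -expRM_natl -expRD; congr expR.
  have -> : (`|m - l i|%N)%:R = (m - l i)%:~R :> R.
    by rewrite -[in RHS](@gez0_abs (m - l i)) ?subr_ge0 ?lm.
  by rewrite intrB; ring.
have yt : expR (m%:~R * t) <= y `^ t.
  rewrite expRM ge0_ler_powR ?nnegrE ?expR_ge0 ?(ltW t0) ?(ltW y0)//.
  rewrite -[leRHS]lnK ?posrE// ler_expR; exact: floor_le.
apply: ler_pM => //.
- by apply: sumr_ge0 => i _; rewrite exprn_ge0 ?expR_ge0.
- apply: sum_expr_inj_le => // i j Pi Pj e.
  apply: linj => //.
  have := lm _ Pi; have := lm _ Pj; rewrite -!(subr_ge0 (l _)) => mj mi.
  move: (congr1 Posz e); rewrite !gez0_abs// => /(congr1 (fun z => m - z)).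
  by rewrite !subKr.
Qed.

(** Hoelder's inequality for sequences when the 1/p_i add up to at least 1, with
    the constant n in place of 1. After normalising B_i = 1 all the terms are at
    most 1, so if t is the largest of the b_i^p_i then the product of the b_i is
    at most t to the power sum_i 1/p_i, hence at most t, hence at most the sum
    of the b_i^p_i. *)
Lemma sum_prod_le (R : realType) (I : finType) (n : nat) (p : 'I_n -> R)
    (b : 'I_n -> I -> R) (B : 'I_n -> R) :
  (forall i, 1 < p i) -> 1 <= \sum_(i < n) (p i)^-1 ->
  (forall i F, 0 <= b i F) -> (forall i, 0 <= B i) ->
  (forall i, \sum_F b i F `^ p i <= B i `^ p i) ->
  \sum_F \prod_(i < n) b i F <= n%:R * \prod_(i < n) B i.
Proof.
move=> p1 sp b0 B0 bB.
have p0 i : 0 < p i by rewrite (lt_trans ltr01).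
have bp i F : b i F `^ p i <= B i `^ p i.
  apply: le_trans (bB i); rewrite (bigD1 F)//= lerDl sumr_ge0// => ? _.
  exact: powR_ge0.
have bleB i F : b i F <= B i.
  rewrite leNgt; apply/negP => /(gt0_ltr_powR (p0 i)).
  by rewrite !nnegrE => /(_ (B0 _) (b0 _ _)); rewrite ltNge bp.
have [i0 /eqP Bi0|Bn0] := pickP (fun i => B i == 0).
  rewrite big1 => [|F _]; first by rewrite mulr_ge0 ?prodr_ge0.
  rewrite (bigD1 i0)//=; have := bleB i0 F; have := b0 i0 F.
  by rewrite Bi0 => h1 h2; rewrite (@le_anti _ _ (b i0 F) 0) ?mul0r ?h1 ?h2.
have Bp i : 0 < B i by rewrite lt_neqAle B0 eq_sym Bn0.
pose c i F := b i F / B i.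
have c0 i F : 0 <= c i F by rewrite divr_ge0.
have c1 i F : c i F <= 1 by rewrite ler_pdivrMr// mul1r.
have cp1 i F : c i F `^ p i <= 1.
  by have := ge0_ler_powR (ltW (p0 i)) (c0 i F) ler01 (c1 i F); rewrite powR1.
have cs i : \sum_F c i F `^ p i <= 1.
  under eq_bigr do rewrite /c powRM ?invr_ge0// -[(B i)^-1]powR_inv1// powRAC
    powR_inv1 ?powR_ge0//.
  by rewrite -mulr_suml ler_pdivrMr ?powR_gt0// mul1r.
have cF F : \prod_(i < n) c i F <= \sum_(i < n) c i F `^ p i.
  have n0 := sum_ge1_gt0 sp.
  pose i0 := Ordinal n0.
  have [im _ imax] := @arg_maxP _ R _ i0 xpredT (fun i => c i F `^ p i) isT.
  set t := c im F `^ p im in imax.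
  have tsum : t <= \sum_(i < n) c i F `^ p i.
    by rewrite (bigD1 im)//= lerDl sumr_ge0// => ? _; exact: powR_ge0.
  apply: le_trans tsum.
  have := powR_ge0 (c im F) (p im); rewrite -/t le_eqVlt => /predU1P[t0|t0].
    rewrite (bigD1 im)//= (powR_eq0_eq0 (esym t0)) mul0r.
    by rewrite -t0.
  have ct i : c i F <= t `^ (p i)^-1.
    rewrite -[leLHS]powRr1// -(@mulfV _ (p i)) ?gt_eqF// powRrM.
    rewrite ge0_ler_powR ?invr_ge0 ?(ltW (p0 i))//.
    - by rewrite nnegrE powR_ge0.
    - by rewrite nnegrE ltW.
    - exact: imax.
  apply: (@le_trans _ _ (\prod_(i < n) t `^ (p i)^-1)).
    by apply: ler_prod => i _; rewrite c0 ct.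
  rewrite /powR gt_eqF// -expR_sum -mulr_suml.
  rewrite -[leRHS]lnK ?posrE// ler_expR.
  by have := @ln_le0 _ t (cp1 _ _); nra.
have -> : \sum_F \prod_(i < n) b i F =
    (\sum_F \prod_(i < n) c i F) * \prod_(i < n) B i.
  rewrite mulr_suml; apply: eq_bigr => F _; rewrite -big_split /=.
  by apply: eq_bigr => i _; rewrite /c divfK// gt_eqF.
rewrite ler_wpM2r ?prodr_ge0//.
apply: (le_trans (ler_sum _ (fun F _ => cF F))).
rewrite exchange_big /= (le_trans (ler_sum _ (fun i _ => cs i)))//.
by rewrite sumr_const card_ord.
Qed.

(** * Principal ancestors in a finite forest *)

Definition record (I : finType) (le : rel I) (l : I -> int) (F : I) : Prop :=
  forall r, le F r -> r != F -> l r < l F.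

(** The last condition makes F the largest among the elements above q of
    maximal level, and so determines F. *)
Definition principal (I : finType) (le : rel I) (l : I -> int) (q F : I)
    : Prop :=
  [/\ le q F, forall r, le q r -> l r <= l F & record le l F].

Section forest.
Variables (I : finType) (le : rel I) (l : I -> int).
Hypothesis le_refl : reflexive le.
Hypothesis le_trans : transitive le.
Hypothesis le_anti : antisymmetric le.
Hypothesis forest : forall q r s, le q r -> le q s -> le r s || le s r.

(** Pick an element above q of maximal level, then, among those of that level,
    one with the fewest elements above it. *)
Lemma principal_exists (q : I) : exists F, principal le l q F.
Proof.
have [r0 qr0 r0max] := @arg_maxP _ _ _ q (le q) l (le_refl q).
have Pr0 : le q r0 && (l r0 == l r0) by rewrite qr0 eqxx.
have [F /andP[qF /eqP lF] Fmax] := @arg_minnP _ r0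
  (fun r => le q r && (l r == l r0)) (fun r => #|[pred s | le r s]|) Pr0.
have top r : le q r -> l r <= l F by rewrite lF; exact: r0max.
exists F; split => // r Fr rF.
have qr := le_trans qF Fr.
rewrite lt_neqAle (top _ qr) andbT; apply/eqP => lr.
have := Fmax r; rewrite qr lr lF eqxx => /(_ isT).
rewrite leqNgt => /negP; apply; apply: proper_card.
apply/properP; split; last first.
  exists F; rewrite !inE ?le_refl//; apply: contra rF => rF.
  by apply/eqP/le_anti; rewrite rF Fr.
by apply/fintype.subsetP => s; rewrite !inE => /(le_trans Fr).
Qed.

Lemma principal_unique (q F G : I) :
  principal le l q F -> principal le l q G -> F = G.
Proof.
move=> [qF topF recF] [qG topG recG]; apply/eqP/negPn/negP => FG.
have /orP[h|h] := forest qF qG.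
  have := recF _ h; rewrite eq_sym => /(_ FG).
  by rewrite ltNge topG.
by have := recG _ h FG; rewrite ltNge topF.
Qed.

(** This is what lets the cubes be sorted by the largest of their principal
    ancestors: the smaller ones then inherit the same largest ancestor. *)
Lemma principal_between (q g F : I) :
  principal le l q F -> le q g -> le g F -> principal le l g F.
Proof.
move=> [qF topF recF] qg gF; split => // r gr.
by apply: topF; exact: le_trans gr.
Qed.

Lemma principal_record (F : I) : record le l F -> principal le l F F.
Proof.
move=> recF; split => // r Fr.
by have [->//|rF] := eqVneq r F; rewrite ltW// recF.
Qed.

Lemma record_inj (F G : I) : record le l F -> record le l G ->
  le F G || le G F -> l F = l G -> F = G.
Proof.
move=> rF rG FG lFG; apply/eqP/negPn/negP => nFG.
move: FG => /orP[h|h].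
  by have := rF _ h; rewrite eq_sym lFG ltxx => /(_ nFG).
by have := rG _ h nFG; rewrite lFG ltxx.
Qed.

End forest.

(** * The Carleson embedding over record sets *)

Definition carleson_cst (R : realType) (t : R) : R :=
  (2 * expR 1) `^ t / (1 - expR (- t)).

Lemma carleson_cst_ge0 (R : realType) (t : R) : 0 < t -> 0 <= carleson_cst t.
Proof.
by move=> t0; rewrite divr_ge0 ?powR_ge0// subr_ge0 expR_le1 oppr_le0 ltW.
Qed.

(** The pointwise form of the Carleson embedding at a point x, with f the value
    of the function at x and a_F the averages over the sets F that contain x.
    The terms with a_F >= 2 f satisfy f a_F^t <= a_F^(t+1) / 2; the averages
    below 2 f have distinct levels, so their powers sum to a constant times
    f^t. *)
Lemma carleson_pointwise (R : realType) (I : finType) (P : pred I)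
    (a : I -> R) (l : I -> int) (t f : R) :
  0 < t -> 0 <= f -> {in P &, injective l} ->
  (forall F, P F -> expR (l F)%:~R <= a F < expR ((l F)%:~R + 1)) ->
  f * \sum_(F | P F) a F `^ t <=
    carleson_cst t * f `^ (t + 1) + 2^-1 * \sum_(F | P F) a F `^ (t + 1).
Proof.
move=> t0 f0 linj la.
have a0 F : P F -> 0 < a F.
  by move=> /la /andP[+ _]; apply: lt_le_trans; exact: expR_gt0.
have t1 x : 0 <= x -> x `^ (t + 1) = x * x `^ t.
  rewrite le_eqVlt => /predU1P[<-|x0].
    by rewrite mul0r powR0 ?gt_eqF// addr_gt0.
  by rewrite powRD ?(gt_eqF x0) ?implybT// powRr1 ?(ltW x0)// mulrC.
move: f0; rewrite le_eqVlt => /predU1P[<-|f0].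
  rewrite mul0r powR0 ?gt_eqF ?addr_gt0// mulr0 add0r mulr_ge0// sumr_ge0//.
  move=> F _; exact: powR_ge0.
pose small F := P F && (a F < 2 * f).
have split_le : f * \sum_(F | P F) a F `^ t <=
    f * \sum_(F | small F) a F `^ t + 2^-1 * \sum_(F | P F) a F `^ (t + 1).
  rewrite [in X in _ <= _ * X + _]big_mkcondr !mulr_sumr -big_split /=.
  apply: ler_sum => F PF; rewrite t1 ?(ltW (a0 _ PF))//.
  have at0 := powR_gt0 t (a0 _ PF); have aF0 := a0 _ PF.
  have h2 : 0 < a F * a F `^ t by rewrite mulr_gt0.
  case: ltP => [h|h]; first by rewrite lerDl mulr_ge0// ltW.
  rewrite mulr0 add0r mulrA ler_wpM2r ?(ltW at0)//.
  by rewrite mulrC ler_pdivlMr// mulrC.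
apply: (le_trans split_le); rewrite lerD2r.
rewrite t1 ?(ltW f0)// mulrCA; rewrite ler_pM2l//.
have : \sum_(F | small F) a F `^ t <=
    expR t * \sum_(F | small F) expR ((l F)%:~R * t).
  rewrite mulr_sumr; apply: ler_sum => F /andP[PF _].
  have -> : expR t * expR ((l F)%:~R * t) = expR (((l F)%:~R + 1) * t).
    by rewrite -expRD; congr expR; ring.
  rewrite expRM ge0_ler_powR ?nnegrE ?expR_ge0 ?(ltW t0) ?(ltW (a0 _ PF))//.
  by have /andP[_ /ltW] := la _ PF.
move/le_trans; apply.
have := @sum_expR_levels_le R I small l t (2 * f) t0.
rewrite mulr_gt0// => /(_ isT).
have sinj : {in small &, injective l}.
  by move=> F G /andP[PF _] /andP[PG _]; exact: linj.
have sle F : small F -> expR (l F)%:~R <= 2 * f.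
  by move=> /andP[/la/andP[h _] h']; exact/ltW/(le_lt_trans h).
move=> /(_ sinj sle) h.
apply: (le_trans (ler_wpM2l (expR_ge0 _) h)).
rewrite /carleson_cst !powRM ?expR_ge0 ?(ltW f0)// -expRM mul1r.
by rewrite le_eqVlt; apply/orP; left; apply/eqP; ring.
Qed.

(** Integrating [carleson_pointwise] with t = p - 1 gives X <= C ||g||^p + X / 2
    for the left-hand side X, because a_F^p mu(F) = a_F^(p-1) \int_F g. As X is
    a finite sum of finite terms, X / 2 can be subtracted. *)
Lemma carleson_embedding d (T : measurableType d) (R : realType)
    (mu : {measure set T -> \bar R}) (I : finType) (Q : I -> set T)
    (P : pred I) (a : I -> R) (l : I -> int) (p : R) (g : T -> R) :
  1 < p ->
  (forall F, measurable (Q F)) -> (forall F, (mu (Q F) < +oo)%E) ->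
  measurable_fun setT g -> (forall x, 0 <= g x) ->
  (forall F, P F -> expR (l F)%:~R <= a F < expR ((l F)%:~R + 1)) ->
  (forall F, P F -> ((a F)%:E * mu (Q F) = \int[mu]_(x in Q F) (g x)%:E)%E) ->
  (forall x F G, P F -> P G -> Q F x -> Q G x -> l F = l G -> F = G) ->
  (\sum_(F | P F) (a F `^ p)%:E * mu (Q F) <=
    (2 * carleson_cst (p - 1))%:E * \int[mu]_x (g x `^ p)%:E)%E.
Proof.
move=> p1 mQ fQ mg g0 la avg linj.
have p0 : 0 < p - 1 by rewrite subr_gt0.
have a0 F : P F -> 0 < a F.
  by move=> /la /andP[+ _]; apply: lt_le_trans; exact: expR_gt0.
have Qfin F : mu (Q F) \is a fin_num by rewrite ge0_fin_numE.
set X := (\sum_(F | P F) _)%E.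
have Xfin : X \is a fin_num.
  by apply/sum_fin_numP => F _ _; rewrite fin_numM.
have powE F x : P F -> (a F `^ p * x = a F `^ (p - 1) * (a F * x)).
  move=> PF; rewrite mulrA; congr (_ * _).
  rewrite -[X in _ = _ * X](powRr1 (ltW (a0 _ PF))) -powRD ?subrK//.
  by rewrite (gt_eqF (a0 _ PF)) implybT.
have intind F (h : T -> R) : (forall x, 0 <= h x) -> measurable_fun setT h ->
    (\int[mu]_(x in Q F) (h x)%:E = \int[mu]_x (h x * \1_(Q F) x)%:E)%E.
  move=> h0 mh; rewrite integral_mkcond; apply: eq_integral => x _.
  by rewrite patchE indicE; case: ifP; rewrite ?mulr1 ?mulr0.
have mind F : measurable_fun setT (\1_(Q F) : T -> R).
  exact: measurable_indic.
have ind0 F x : 0 <= \1_(Q F) x :> R by [].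
have sumI (b : I -> R) (h : T -> R) : (forall x, 0 <= h x) ->
    (forall F, 0 <= b F) -> measurable_fun setT h ->
    (\sum_(F | P F) (b F)%:E * \int[mu]_(x in Q F) (h x)%:E =
     \int[mu]_x (\sum_(F | P F) b F * (h x * \1_(Q F) x))%:E)%E.
  move=> h0 b0 mh.
  rewrite -[LHS]big_filter.
  under [RHS]eq_integral do rewrite -sumEFin -big_filter.
  rewrite ge0_integral_sum//; first last.
  - by move=> F x _; rewrite lee_fin !mulr_ge0.
  - move=> F; apply/measurable_EFinP; apply: measurable_funM => //.
    exact: measurable_funM.
  apply: eq_bigr => F _; rewrite intind//.
  under [RHS]eq_integral do rewrite EFinM.
  rewrite ge0_integralZl//.
  - by apply/measurable_EFinP; exact: measurable_funM.
  - by move=> x _; rewrite lee_fin mulr_ge0.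
  - by rewrite lee_fin.
have msum (b : I -> R) (h : T -> R) : measurable_fun setT h ->
    measurable_fun setT (fun x => \sum_(F | P F) b F * (h x * \1_(Q F) x)).
  move=> mh; under eq_fun do rewrite -big_filter.
  apply: measurable_sum => F; apply: measurable_funM => //.
  exact: measurable_funM.
have XE : X = (\int[mu]_x
    (\sum_(F | P F) a F `^ (p - 1) * (g x * \1_(Q F) x))%:E)%E.
  rewrite -sumI//; last by move=> F; exact: powR_ge0.
  apply: eq_bigr => F PF; rewrite -avg// -(fineK (Qfin F)) -!EFinM.
  by rewrite powE.
have XE' : X = (\int[mu]_x
    (\sum_(F | P F) a F `^ p * (cst 1 x * \1_(Q F) x))%:E)%E.
  rewrite -(sumI (fun F => a F `^ p) (cst 1))//;
    last by move=> F; exact: powR_ge0.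
  apply: eq_bigr => F PF; congr (_ * _)%E.
  by rewrite -[LHS]mul1e -integral_cst.
have mgp : measurable_fun setT (fun x => g x `^ p).
  exact: (@measurableT_comp _ _ _ _ _ _ (@powR R ^~ p)).
have C0 := carleson_cst_ge0 p0.
have : (X <= (carleson_cst (p - 1))%:E * \int[mu]_x (g x `^ p)%:E
    + (2^-1)%:E * X)%E.
  rewrite [in leRHS]XE' {1}XE.
  have mS : measurable_fun setT
      (fun x => \sum_(F | P F) a F `^ p * (cst 1 x * \1_(Q F) x)).
    exact: msum.
  have S0 x : 0 <= \sum_(F | P F) a F `^ p * (cst 1 x * \1_(Q F) x).
    by apply: sumr_ge0 => F _; rewrite !mulr_ge0 ?powR_ge0.
  rewrite -!ge0_integralZl//; first last.
  - by move=> x _; rewrite lee_fin powR_ge0.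
  - exact/measurable_EFinP.
  - by move=> x _; rewrite lee_fin.
  - exact/measurable_EFinP.
  rewrite -ge0_integralD//; first last.
   - apply: measurable_funeM; exact/measurable_EFinP.
  - by move=> x _; rewrite mule_ge0 ?lee_fin.
  - apply: measurable_funeM; exact/measurable_EFinP.
  - by move=> x _; rewrite mule_ge0 ?lee_fin ?powR_ge0.
  apply: ge0_le_integral => //.
  - move=> x _; rewrite lee_fin; apply: sumr_ge0 => F _.
    by rewrite !mulr_ge0 ?powR_ge0.
  - by apply/measurable_EFinP; exact: msum.
  - by apply: emeasurable_funD; apply: measurable_funeM; exact/measurable_EFinP.
  move=> x _; rewrite -!EFinM -EFinD lee_fin.
  pose Px F := P F && (x \in Q F).
  have cut (b : I -> R) y : \sum_(F | P F) b F * (y * \1_(Q F) x) =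
      y * \sum_(F | Px F) b F.
    rewrite [in RHS]big_mkcondr mulr_sumr; apply: eq_bigr => F _.
    by rewrite indicE; case: (x \in Q F); rewrite ?mulr1 ?mulr0// mulrC.
  rewrite !cut /= mul1r.
  have := @carleson_pointwise R I Px a l (p - 1) (g x) p0 (g0 x).
  rewrite subrK; apply.
    move=> F G /andP[PF /set_mem xF] /andP[PG /set_mem xG].
    exact: linj xF xG.
  by move=> F /andP[PF _]; exact: la.
(* The integral of g^p may be infinite; the constant is positive, so that the
   bound is then trivial. *)
set Y := (\int[mu]_x _)%E.
have Y0 : (0 <= Y)%E by apply: integral_ge0 => x _; rewrite lee_fin powR_ge0.
rewrite -(fineK Xfin).
case: Y Y0 => [y||]// y0; last first.
  move=> _.
  have : (0 < 2 * carleson_cst (p - 1)).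
    rewrite mulr_gt0// /carleson_cst divr_gt0 ?powR_gt0 ?mulr_gt0 ?expR_gt0//.
    by rewrite subr_gt0 expR_lt1 oppr_lt0.
  by move=> c0; rewrite gt0_muley ?lte_fin// leey.
rewrite -!EFinM -EFinD !lee_fin => h; lra.
Qed.

(** * Lebesgue spaces *)

Lemma LnormE d (T : measurableType d) (R : realType)
    (mu : {measure set T -> \bar R}) (f : T -> R) (p : R) :
  ('N[mu]_(p%:E)[EFin \o f] = (\int[mu]_x (`|f x| `^ p)%:E) `^ p^-1)%E.
Proof. by rewrite unlock. Qed.

Lemma Lfun_Lnorm_lty d (T : measurableType d) (R : realType)
    (mu : {measure set T -> \bar R}) (f : T -> R) (p : \bar R) :
  (f \in Lfun mu p) <->
  measurable_fun setT f /\ ('N[mu]_p[EFin \o f] < +oo)%E.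
Proof.
split=> [fL|[mf fp]].
  split; first exact: set_mem (sub_Lfun_mfun fL).
  exact: set_mem (sub_Lfun_finLfun fL).
by apply/andP; split; apply: mem_set.
Qed.

Lemma Lfun_fin d (T : measurableType d) (R : realType)
    (mu : {measure set T -> \bar R}) (f : T -> R) (p : \bar R) :
  f \in Lfun mu p -> 'N[mu]_p[EFin \o f]%E \is a fin_num.
Proof. by move=> /Lfun_Lnorm_lty[_ h]; rewrite ge0_fin_numE ?Lnorm_ge0. Qed.

Lemma Lfun_abs d (T : measurableType d) (R : realType)
    (mu : {measure set T -> \bar R}) (f : T -> R) (p : \bar R) :
  f \in Lfun mu p -> (fun x => `|f x|) \in Lfun mu p.
Proof.
move=> /Lfun_Lnorm_lty[mf fp]; apply/Lfun_Lnorm_lty; split.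
  exact: measurableT_comp.
by rewrite (Lnorm_abse mu (EFin \o f)).
Qed.

Lemma Lfun_integral_powR d (T : measurableType d) (R : realType)
    (mu : {measure set T -> \bar R}) (f : T -> R) (p : R) : 0 < p ->
  f \in Lfun mu p%:E ->
  (\int[mu]_x (`|f x| `^ p)%:E =
    (fine 'N[mu]_(p%:E)[EFin \o f] `^ p)%:E)%E.
Proof.
move=> p0 fL; rewrite -poweR_EFin fineK ?Lfun_fin// poweR_Lnorm ?gt_eqF//.
Qed.

Lemma integrable_cst_lty d (T : measurableType d) (R : realType)
    (mu : {measure set T -> \bar R}) (D : set T) (c : R) :
  measurable D -> (mu D < +oo)%E -> mu.-integrable D (EFin \o cst c).
Proof.
move=> mD fD; apply/integrableP; split.
  by apply/measurable_EFinP; exact: measurable_cst.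
under eq_integral do rewrite /=.
by rewrite integral_cst// lte_mul_pinfty// ?lee_fin ?normr_ge0.
Qed.

(** On a set of finite measure the bound 1 + |f|^p of |f| is integrable,
    although the whole space may have infinite measure. *)
Lemma Lfun_integrable_on d (T : measurableType d) (R : realType)
    (mu : {measure set T -> \bar R}) (f : T -> R) (p : R) (D : set T) :
  1 <= p -> measurable D -> (mu D < +oo)%E -> f \in Lfun mu p%:E ->
  mu.-integrable D (EFin \o f).
Proof.
move=> p1 mD fD fL; have p0 : 0 < p by rewrite (lt_le_trans ltr01).
have [mf fp] := (Lfun_Lnorm_lty _ _ _).1 fL.
have mfp : measurable_fun setT (fun x => `|f x| `^ p).
  apply: (@measurableT_comp _ _ _ _ _ _ (@powR R ^~ p)) => //.
  exact: measurableT_comp.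
have i1 : mu.-integrable D (EFin \o cst (1 : R)).
  exact: integrable_cst_lty.
have ip : mu.-integrable D (EFin \o (fun x => `|f x| `^ p)).
  apply: (@integrableS _ _ _ _ setT) => //; apply/integrableP; split.
    exact/measurable_EFinP.
  under eq_integral do rewrite /= ger0_norm ?powR_ge0//.
  by rewrite Lfun_integral_powR// ltry.
apply: (le_integrable mD _ _ (integrableD mD i1 ip)).
  by apply/measurable_EFinP; exact: measurable_funTS.
move=> x _; rewrite /= lee_fin [leRHS]ger0_norm ?addr_ge0 ?powR_ge0//.
have [f1|f1] := leP `|f x| 1; first by rewrite (le_trans f1)// lerDl powR_ge0.
rewrite -[leLHS]powRr1// (le_trans (ler_powR (ltW f1) p1))// lerDr//.
Qed.

Lemma Lnorm_indic d (T : measurableType d) (R : realType)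
    (mu : {measure set T -> \bar R}) (D : set T) (p : R) :
  0 < p -> measurable D ->
  ('N[mu]_(p%:E)[EFin \o \1_D] = mu D `^ p^-1)%E.
Proof.
move=> p0 mD; rewrite LnormE; congr poweR.
rewrite -[in RHS](setIT D) -integral_indic//.
apply: eq_integral => x _; rewrite indicE; case: (x \in D) => /=.
  by rewrite normr1 powR1.
by rewrite normr0 powR0// gt_eqF.
Qed.

(** A function above a_G on each G in P. Taking the l^p sum of the a_G 1_G
    rather than their supremum keeps this property and makes the p-th power of
    the norm exactly the sum of the a_G^p mu(G). *)
Definition packet (R : realType) (T : Type) (I : finType) (Q : I -> set T)
    (P : pred I) (a : I -> R) (p : R) (x : T) : R :=
  (\sum_(G | P G) a G `^ p * \1_(Q G) x) `^ p^-1.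

Section packet.
Context d (T : measurableType d) (R : realType).
Variables (mu : {measure set T -> \bar R}) (I : finType) (Q : I -> set T).
Variables (P : pred I) (a : I -> R) (p : R).
Hypotheses (p1 : 1 <= p) (mQ : forall G, measurable (Q G)).
Hypothesis fQ : forall G, (mu (Q G) < +oo)%E.
Hypothesis a0 : forall G, 0 <= a G.

Let p0 : 0 < p. Proof. exact: lt_le_trans p1. Qed.

Let packet_sum_ge0 x : 0 <= \sum_(G | P G) a G `^ p * \1_(Q G) x.
Proof. by apply: sumr_ge0 => G _; rewrite mulr_ge0 ?powR_ge0. Qed.

Let measurable_packet_sum :
  measurable_fun setT (fun x => \sum_(G | P G) a G `^ p * \1_(Q G) x).
Proof.
under eq_fun do rewrite -big_filter.
by apply: measurable_sum => G; apply: measurable_funM.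
Qed.

Let Lnorm_packet0 : 'N[mu]_(p%:E)[EFin \o packet Q P a p]%E =
  ((\sum_(G | P G) a G `^ p * fine (mu (Q G))) `^ p^-1)%:E.
Proof.
rewrite LnormE -poweR_EFin; congr poweR.
under eq_integral.
  move=> x _; rewrite ger0_norm ?powR_ge0// /packet -powRrM mulVf ?gt_eqF//.
  rewrite powRr1// -sumEFin -big_filter; over.
rewrite ge0_integral_sum//; first last.
- by move=> G x _; rewrite lee_fin mulr_ge0 ?powR_ge0.
- by move=> G; apply/measurable_EFinP; apply: measurable_funM.
rewrite big_filter -sumEFin; apply: eq_bigr => G _.
under eq_integral do rewrite EFinM.
rewrite ge0_integralZl//; first last.
- by rewrite lee_fin powR_ge0.
- by apply/measurable_EFinP; exact: measurable_indic.
by rewrite integral_indic// setIT EFinM fineK// ge0_fin_numE.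
Qed.

Lemma Lnorm_packet : fine 'N[mu]_(p%:E)[EFin \o packet Q P a p]%E =
  (\sum_(G | P G) a G `^ p * fine (mu (Q G))) `^ p^-1.
Proof. by rewrite Lnorm_packet0. Qed.

Lemma packet_Lfun : packet Q P a p \in Lfun mu p%:E.
Proof.
apply/Lfun_Lnorm_lty; split; last by rewrite Lnorm_packet0 ltry.
exact: (@measurableT_comp _ _ _ _ _ _ (@powR R ^~ p^-1)).
Qed.

Lemma packet_ge0 x : 0 <= packet Q P a p x.
Proof. exact: powR_ge0. Qed.

Lemma packet_ge (G : I) (x : T) : P G -> Q G x -> a G <= packet Q P a p x.
Proof.
move=> PG Gx; rewrite -[leLHS]powRr1// -(@mulfV _ p) ?gt_eqF// powRrM.
rewrite ge0_ler_powR ?nnegrE ?powR_ge0 ?invr_ge0 ?(ltW p0)//.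
rewrite (bigD1 G)//= indicE mem_set// mulr1 lerDl sumr_ge0// => F _.
by rewrite mulr_ge0 ?powR_ge0.
Qed.

Lemma Rintegral_packet_ge (G : I) (D : set T) : P G -> measurable D ->
  D `<=` Q G -> a G * fine (mu D) <= \int[mu]_(x in D) packet Q P a p x.
Proof.
move=> PG mD DG.
have fD : (mu D < +oo)%E.
  by rewrite (le_lt_trans _ (fQ G))// le_measure ?mem_set.
rewrite -Rintegral_cst//; apply: le_Rintegral => //.
- exact: (integrable_cst_lty (a G)).
- exact: (Lfun_integrable_on p1 mD fD packet_Lfun).
- by move=> x /DG; exact: packet_ge.
Qed.

End packet.

(** * The embedding for finitely many nested sets *)

(** One factor n comes from the choice of the index of the largest principal
    ancestor, the other from [sum_prod_le]; each replacement of a function by a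
    principal average costs a factor e. *)
Definition embedding_cst (R : realType) (n : nat) (p : 'I_n -> R) : R :=
  n%:R * (expR 1 ^+ n *
    (n%:R * \prod_(i < n) (2 * carleson_cst (p i - 1)) `^ (p i)^-1)).

Section finite_embedding.
Context d (T : measurableType d) (R : realType).
Variables (n : nat) (p : 'I_n -> R).
Hypotheses (p1 : forall i, 1 < p i) (sum_p : 1 <= \sum_(i < n) (p i)^-1).
Variables (I : finType) (Q : I -> set T).
Hypothesis mQ : forall q, measurable (Q q).
Hypothesis Qinj : injective Q.
Hypothesis nested : forall q r,
  [\/ Q q `<=` Q r, Q r `<=` Q q | Q q `&` Q r = set0].
Variable sigma : 'I_n -> {measure set T -> \bar R}.
Hypothesis sigma_fin : forall i q, (sigma i (Q q) < +oo)%E.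
Variables (K : I -> R) (c : R) (g : 'I_n -> T -> R).
Hypotheses (K0 : forall q, 0 <= K q) (c0 : 0 <= c).
Hypotheses (gL : forall i, g i \in Lfun (sigma i) (p i)%:E).
Hypotheses (g0 : forall i x, 0 <= g i x).
Hypothesis g_pos : forall i q, 0 < \int[sigma i]_(x in Q q) g i x.

Local Notation s i q := (fine (sigma i (Q q))).

Hypothesis testing : forall (j : 'I_n) (F : I) (h : 'I_n -> T -> R),
  (forall i, h i \in Lfun (sigma i) (p i)%:E) -> (forall i x, 0 <= h i x) ->
  \sum_(q | `[< Q q `<=` Q F >]) K q * s j q *
      \prod_(i < n | i != j) \int[sigma i]_(x in Q q) h i x
  <= c * s j F `^ (p j)^-1 *
     \prod_(i < n | i != j) fine 'N[sigma i]_((p i)%:E)[EFin \o h i].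

Let p0 i : 0 < p i. Proof. exact: lt_trans (p1 i). Qed.

Let below (q r : I) : bool := `[< Q q `<=` Q r >].

Let below_refl : reflexive below. Proof. by move=> q; apply/asboolP. Qed.

Let below_trans : transitive below.
Proof.
by move=> q r t /asboolP rq /asboolP qt; apply/asboolP; exact: subset_trans qt.
Qed.

Let below_anti : antisymmetric below.
Proof.
move=> q r /andP[/asboolP qr /asboolP rq]; apply: Qinj; exact/seteqP.
Qed.

Let s_pos i q : 0 < s i q.
Proof.
rewrite fine_gt0// sigma_fin andbT lt_neqAle measure_ge0 andbT eq_sym.
apply/eqP => s0; have := g_pos i q.
rewrite /Rintegral null_set_integral ?ltxx//; apply/measurable_EFinP.
by apply: measurable_funTS; have [] := (Lfun_Lnorm_lty _ _ _).1 (gL i).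
Qed.

Let meet_comparable q r x : Q q x -> Q r x -> below q r || below r q.
Proof.
move=> qx rx; case: (nested q r) => [h|h|h].
- by apply/orP; left; apply/asboolP.
- by apply/orP; right; apply/asboolP.
- by have : (Q q `&` Q r) x by []; rewrite h.
Qed.

Let Q_nonempty (i0 : 'I_n) q : exists x, Q q x.
Proof.
apply/set0P/eqP => Q0.
by have := s_pos i0 q; rewrite Q0 measure0 ltxx.
Qed.

Let n_gt0 : (0 < n)%N. Proof. exact: sum_ge1_gt0 sum_p. Qed.

Let forest q r t : below q r -> below q t -> below r t || below t r.
Proof.
move=> /asboolP qr /asboolP qt; have [x qx] := Q_nonempty (Ordinal n_gt0) q.
exact: (meet_comparable (qr _ qx) (qt _ qx)).
Qed.

Let A i q : R := \int[sigma i]_(x in Q q) g i x.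
Let a i q : R := A i q / s i q.
Let l i q : int := Num.floor (ln (a i q)).

Let a_pos i q : 0 < a i q.
Proof. by rewrite divr_gt0// g_pos. Qed.

Let level i q : expR (l i q)%:~R <= a i q < expR ((l i q)%:~R + 1).
Proof.
rewrite -[a i q]lnK ?posrE// ler_expR ltr_expR.
by rewrite floor_le/= -(intrD _ _ 1) floorD1_gt.
Qed.

Let level_le i q r : l i q <= l i r -> a i q <= expR 1 * a i r.
Proof.
move=> lqr; have /andP[_ /ltW h1] := level i q; have /andP[h2 _] := level i r.
apply: (le_trans h1); rewrite expRD mulrC ler_wpM2l ?expR_ge0//.
by apply: le_trans h2; rewrite ler_expR ler_int.
Qed.

Let A_avg i q : A i q = a i q * s i q.
Proof. by rewrite /a divfK// gt_eqF. Qed.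

Let rec i F : bool := `[< record below (l i) F >].

Let carleson i : \sum_(G | rec i G) a i G `^ p i * s i G <=
  ((2 * carleson_cst (p i - 1)) `^ (p i)^-1 *
    fine 'N[sigma i]_((p i)%:E)[EFin \o g i]) `^ p i.
Proof.
have C0 : 0 <= 2 * carleson_cst (p i - 1).
  by rewrite mulr_ge0// carleson_cst_ge0// subr_gt0.
have N0 : 0 <= fine 'N[sigma i]_((p i)%:E)[EFin \o g i].
  by rewrite fine_ge0// Lnorm_ge0.
rewrite powRM ?powR_ge0// -powRrM mulVf ?gt_eqF// powRr1//.
rewrite -lee_fin -sumEFin EFinM -Lfun_integral_powR//.
under [X in (_ <= _ * X)%E]eq_integral do rewrite ger0_norm ?g0//.
have mg : measurable_fun setT (g i).
  by have [] := (Lfun_Lnorm_lty _ _ _).1 (gL i).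
have := @carleson_embedding _ T R (sigma i) I Q (rec i) (a i) (l i) (p i) (g i)
  (p1 i) mQ (sigma_fin i) mg (g0 i) (fun F _ => level i F).
have finE F : (a i F * s i F)%:E = ((a i F)%:E * sigma i (Q F))%E.
  by rewrite EFinM fineK// ge0_fin_numE.
move=> H; under eq_bigr => F _ do
  rewrite EFinM fineK ?ge0_fin_numE//.
apply: H.
- move=> F _; rewrite -finE -A_avg /A /Rintegral fineK//.
  apply: integrable_fin_num => //.
  exact: (Lfun_integrable_on (ltW (p1 i)) (mQ F) (sigma_fin i F) (gL i)).
- move=> x F G /asboolP rF /asboolP rG Fx Gx.
  exact: (record_inj rF rG (meet_comparable Fx Gx)).
Qed.

(** The parallel corona argument described at the top. *)
Lemma finite_embedding :
  \sum_q K q * \prod_(i < n) \int[sigma i]_(x in Q q) g i x <=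
  embedding_cst p * c *
    \prod_(i < n) fine 'N[sigma i]_((p i)%:E)[EFin \o g i].
Proof.
have /choice[pi piP] : forall iq : 'I_n * I,
    exists F, principal below (l iq.1) iq.2 F.
  by move=> [i q]; exact: principal_exists.
have pi_le i q : below q (pi (i, q)) by have [] := piP (i, q).
have pi_level i q : l i q <= l i (pi (i, q)).
  by have [_ + _] := piP (i, q); apply.
have pi_rec i q : rec i (pi (i, q)).
  by apply/asboolP; have [] := piP (i, q).
have pi_between i q r : below q r -> below r (pi (i, q)) ->
    pi (i, r) = pi (i, q).
  move=> qr rp; apply: (principal_unique forest (piP (i, r))).
  exact: (principal_between below_trans (piP (i, q))).
have pi_id i F : rec i F -> pi (i, F) = F.
  move=> /asboolP rF; apply: (principal_unique forest (piP (i, F))).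
  exact: (principal_record below_refl).
(* J q is the index of the largest principal ancestor of q: the one with the
   fewest sets above it. *)
have /choice[J JP] : forall q, exists j : 'I_n,
    forall i, below (pi (i, q)) (pi (j, q)).
  move=> q.
  have [j _ jmin] := @arg_minnP _ (Ordinal n_gt0) xpredT
    (fun j => #|[pred r | below (pi (j, q)) r]|) isT.
  exists j => i; have /orP[//|ji] := forest (pi_le i q) (pi_le j q).
  apply/negPn/negP => nij; have := jmin i isT; rewrite leqNgt => /negP; apply.
  apply: proper_card; apply/properP; split.
    by apply/fintype.subsetP => r ir; exact: (below_trans ji ir).
  by exists (pi (j, q)); [exact: below_refl|exact: nij].
(* The packets for different F partition the principal sets of g_i, which is
   why the sum of b j i F `^ p i over F reduces to the Carleson sum. *)
pose b j i F := (\sum_(G | rec i G && (pi (j, G) == F)) a i G `^ p i * s i G)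
  `^ (p i)^-1.
have as0 i G : 0 <= a i G `^ p i * s i G.
  by rewrite mulr_ge0 ?powR_ge0 ?(ltW (s_pos _ _)).
have b0 j i F : 0 <= b j i F by exact: powR_ge0.
have bp j i F : b j i F `^ p i =
    \sum_(G | rec i G && (pi (j, G) == F)) a i G `^ p i * s i G.
  by rewrite /b -powRrM mulVf ?gt_eqF// powRr1// sumr_ge0.
pose B i := (2 * carleson_cst (p i - 1)) `^ (p i)^-1 *
    fine 'N[sigma i]_((p i)%:E)[EFin \o g i].
have bB j i : \sum_F b j i F `^ p i <= B i `^ p i.
  apply: le_trans (carleson i); under eq_bigr do rewrite bp.
  by rewrite [leRHS](partition_big (fun G => pi (j, G)) xpredT).
have B0 i : 0 <= B i by rewrite mulr_ge0 ?powR_ge0// fine_ge0// Lnorm_ge0.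
have hold j := sum_prod_le p1 sum_p (b0 j) B0 (bB j).
have block j F :
    \sum_(q | (J q == j) && (pi (j, q) == F)) K q * \prod_(i < n) A i q <=
    expR 1 ^+ n * c * \prod_(i < n) b j i F.
  have [q0 /andP[_ /eqP q0F]|none] :=
    pickP (fun q => (J q == j) && (pi (j, q) == F)); last first.
    rewrite big_pred0// !mulr_ge0 ?exprn_ge0 ?expR_ge0//.
    by apply: prodr_ge0 => i _.
  have recF : rec j F by rewrite -q0F.
  pose P i G := rec i G && (pi (j, G) == F).
  pose h i := packet Q (P i) (a i) (p i).
  have hL i : h i \in Lfun (sigma i) (p i)%:E.
    by apply: packet_Lfun => //; exact: ltW.
  have h0 i x : 0 <= h i x by exact: packet_ge0.
  have Nh i : fine 'N[sigma i]_((p i)%:E)[EFin \o h i] = b j i F.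
    by apply: Lnorm_packet => //; exact: ltW.
  have term q : J q = j -> pi (j, q) = F ->
      K q * \prod_(i < n) A i q <= expR 1 ^+ n * a j F *
       (K q * s j q * \prod_(i < n | i != j) \int[sigma i]_(x in Q q) h i x).
    move=> Jq piq.
    have Aj : A j q <= expR 1 * (a j F * s j q).
      rewrite A_avg mulrA ler_wpM2r ?(ltW (s_pos _ _))// level_le//.
      by rewrite -piq.
    have Ai i : A i q <= expR 1 * \int[sigma i]_(x in Q q) h i x.
      apply: (@le_trans _ _ (expR 1 * (a i (pi (i, q)) * s i q))).
        by rewrite A_avg mulrA ler_wpM2r ?(ltW (s_pos _ _))// level_le.
      rewrite ler_wpM2l ?expR_ge0//; apply: Rintegral_packet_ge => //.
      - exact: ltW.
      - by move=> G; exact: ltW.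
      - have ij : below (pi (i, q)) (pi (j, q)) by rewrite -Jq; exact: JP.
        by rewrite /P pi_rec (pi_between _ _ _ (pi_le i q) ij) piq eqxx.
      - exact/asboolP/pi_le.
    have A0 i : 0 <= A i q by exact/ltW/g_pos.
    have -> : expR 1 ^+ n * a j F * (K q * s j q *
        \prod_(i < n | i != j) \int[sigma i]_(x in Q q) h i x) =
        K q * (expR 1 * (a j F * s j q) *
        \prod_(i < n | i != j) (expR 1 * \int[sigma i]_(x in Q q) h i x)).
      rewrite big_split /= prodr_const.
      have -> : expR 1 ^+ n = expR 1 * expR 1 ^+ #|[pred i | i != j]| :> R.
        rewrite -exprS; congr (_ ^+ _).
        rewrite -[LHS]card_ord (cardD1 j) add1n; congr _.+1.
        by apply: eq_card => i; rewrite !inE andbT.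
      ring.
    rewrite ler_wpM2l// (bigD1 j)//=; apply: ler_pM => //.
      by apply: prodr_ge0.
    by apply: ler_prod => i _; rewrite A0 Ai.
  have aE0 : 0 <= expR 1 ^+ n * a j F.
    by apply: mulr_ge0; [rewrite exprn_ge0 ?expR_ge0|exact/ltW/a_pos].
  apply: (@le_trans _ _ (expR 1 ^+ n * a j F * (\sum_(q | below q F)
     K q * s j q * \prod_(i < n | i != j) \int[sigma i]_(x in Q q) h i x))).
    rewrite mulr_sumr [leLHS]big_mkcond [leRHS]big_mkcond.
    apply: ler_sum => q _.
    case: ifPn => [/andP[/eqP Jq /eqP piq]|_].
      by rewrite -{1}piq pi_le term.
    case: ifP => // _; apply: mulr_ge0 => //; apply: mulr_ge0.
      by rewrite mulr_ge0 ?(ltW (s_pos _ _)).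
    by apply: prodr_ge0 => i _; exact: Rintegral_ge0.
  apply: (le_trans (ler_wpM2l aE0 (testing j F hL h0))).
  under eq_bigr do rewrite Nh.
  rewrite [in leRHS](bigD1 j)//=.
  (* F is its own principal ancestor, hence one of the terms of b j j F. *)
  have bj : a j F * s j F `^ (p j)^-1 <= b j j F.
    rewrite -[a j F]powRr1 ?(ltW (a_pos _ _))//.
    rewrite -(@mulfV _ (p j)) ?gt_eqF// powRrM.
    rewrite -powRM ?powR_ge0 ?(ltW (s_pos _ _))// /b.
    rewrite ge0_ler_powR ?invr_ge0 ?(ltW (p0 _))// ?nnegrE ?as0 ?sumr_ge0//.
    by rewrite (bigD1 F) ?recF ?pi_id ?eqxx//= lerDl sumr_ge0.
  have Pi0 : 0 <= \prod_(i < n | i != j) b j i F by apply: prodr_ge0.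
  rewrite [leLHS](_ : _ = expR 1 ^+ n * c * (a j F * s j F `^ (p j)^-1 *
    \prod_(i < n | i != j) b j i F)); last by ring.
  by rewrite ler_wpM2l ?mulr_ge0 ?exprn_ge0 ?expR_ge0// ler_wpM2r.
rewrite (partition_big J xpredT)//=.
have -> : embedding_cst p * c *
    \prod_(i < n) fine 'N[sigma i]_((p i)%:E)[EFin \o g i] =
    \sum_(j < n) expR 1 ^+ n * c * (n%:R * \prod_(i < n) B i).
  rewrite sumr_const card_ord -mulr_natl /embedding_cst /B big_split /=.
  by ring.
apply: ler_sum => j _; rewrite (partition_big (fun q => pi (j, q)) xpredT)//=.
apply: (le_trans (ler_sum _ (fun F _ => block j F))).
by rewrite -mulr_sumr ler_wpM2l ?hold ?mulr_ge0 ?exprn_ge0 ?expR_ge0.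
Qed.

End finite_embedding.

(** * Dyadic cubes *)

(** In units of 2^-k' both ends of the larger interval are integers, and so are
    those of the smaller one; integers u, v with u <= 2^k' x < v satisfy
    u + 1 <= v, which compares the end points. *)
Lemma dyadic_interval_nested (R : realType) (k k' m m' : int) (x y : R) :
  k <= k' ->
  2 ^ (- k) * m%:~R <= x < 2 ^ (- k) * (m%:~R + 1) ->
  2 ^ (- k') * m'%:~R <= x < 2 ^ (- k') * (m'%:~R + 1) ->
  2 ^ (- k') * m'%:~R <= y < 2 ^ (- k') * (m'%:~R + 1) ->
  2 ^ (- k) * m%:~R <= y < 2 ^ (- k) * (m%:~R + 1).
Proof.
move=> kk' /andP[mx xm] /andP[mx' xm'] /andP[my ym].
pose N := (2 ^ `|k' - k|)%N.
have kE : 2 ^ (- k) = 2 ^ (- k') * N%:Z%:~R :> R.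
  have -> : - k = - k' + `|k' - k|%N%:Z by rewrite gez0_abs ?subr_ge0// addKr.
  rewrite expfzDr ?pnatr_eq0//; congr (_ * _).
  by rewrite /N -exprnP pmulrn -natrX.
have e0 : (0 : R) < 2 ^ (- k') by rewrite exprz_gt0.
have sep (u v : int) :
    2 ^ (- k') * u%:~R <= x -> x < 2 ^ (- k') * v%:~R -> u + 1 <= v.
  move=> ux xv; have := le_lt_trans ux xv.
  by rewrite ltr_pM2l// ltr_int lezD1.
rewrite !kE -!mulrA -(intrD _ _ 1) -!intrM in mx xm *.
rewrite -(intrD _ _ 1) in xm' ym.
have h1 := sep _ _ mx xm'; have h2 := sep _ _ mx' xm.
apply/andP; split.
  by rewrite (le_trans _ my)// ler_pM2l// ler_int -(lerD2r 1).
by rewrite (lt_le_trans ym)// ler_pM2l// ler_int.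
Qed.

Lemma dyadic_cubes_nested (R : realType) (d : nat) (P Q : set (borelRd R d)) :
  @dyadic_cubes R d P -> @dyadic_cubes R d Q ->
  [\/ P `<=` Q, Q `<=` P | P `&` Q = set0].
Proof.
move=> [k [m ->]] [k' [m' ->]].
have [[x [xP xQ]]|disj] :=
    pselect (@dyadic_cube R d k m `&` @dyadic_cube R d k' m' !=set0);
  last by constructor 3; apply/seteqP; split => // x Hx; case: disj; exists x.
have [kk|kk] := leP k k'.
- constructor 2 => y yQ i.
  exact: (dyadic_interval_nested kk (xP i) (xQ i) (yQ i)).
- constructor 1 => y yP i.
  exact: (dyadic_interval_nested (ltW kk) (xQ i) (xP i) (yP i)).
Qed.

Lemma dyadic_cubes_measurable (R : realType) (d : nat) (Q : set (borelRd R d)) :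
  @dyadic_cubes R d Q -> measurable Q.
Proof.
move=> [k [m ->]].
have lt_open (c : R) (i : 'I_d) :
    measurable ([set x : 'rV[R]_d | x ord0 i < c] : set (borelRd R d)).
  apply: sub_sigma_algebra.
  have /= := @open_comp _ _ (fun M : 'rV[R]_d => M ord0 i) [set y | y < c].
  by apply; [move=> x _; exact: coord_continuous|exact: open_lt].
have -> : @dyadic_cube R d k m = \bigcap_(i in [set: 'I_d])
   (([set x : 'rV[R]_d | x ord0 i < 2 ^ (- k) * ((m ord0 i)%:~R + 1)]
     `\` [set x : 'rV[R]_d | x ord0 i < 2 ^ (- k) * (m ord0 i)%:~R])
     : set (borelRd R d)).
  apply/seteqP; split => x.
    move=> h i _; have /andP[h1 h2] := h i; split => //=.
    by apply/negP; rewrite -leNgt.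
  by move=> h i; have [h1 /negP] := h i I; rewrite -leNgt => h2; apply/andP.
apply: fin_bigcap_measurable => [|i _]; first exact: finite_finset.
by apply: measurableD; exact: lt_open.
Qed.

Lemma sum_fset_le_esum (R : realType) (T : choiceType) (A : {fset T})
    (P : pred T) (D : set T) (t : T -> R) (u : T -> \bar R) :
  (forall x, x \in A -> P x -> D x) ->
  (forall x, x \in A -> P x -> ((t x)%:E <= u x)%E) ->
  ((\sum_(q : A | P (\val q)) t (\val q))%:E <= \esum_(x in D) u x)%E.
Proof.
move=> AD tu.
rewrite -(@finmap.big_seq_fsetE _ _ _ T A P) -sumEFin.
apply: (@le_trans _ _ (\sum_(x <- [seq x <- A | P x]) u x)).
  rewrite big_filter big_seq_cond [leRHS]big_seq_cond; apply: lee_sum => x.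
  by move=> /andP[xA Px]; exact: tu.
apply: esum_ge; exists [set` [seq x <- A | P x]].
  split; first exact: finite_seq.
  by move=> x /=; rewrite mem_filter => /andP[Px xA]; exact: AD.
by rewrite fsbig_seq// filter_uniq// finmap.fset_uniq.
Qed.

(** * Equivalence of the two inequalities *)

(** Every finite partial sum is bounded by [finite_embedding], applied to the
    |f_i| and to those cubes on which all their integrals are positive; the
    other cubes contribute nothing. *)
Lemma embedding_of_testing (R : realType) (d n : nat) (p : 'I_n -> R)
    (K : set (borelRd R d) -> R)
    (sigma : 'I_n -> {measure set (borelRd R d) -> \bar R}) (c : R) :
  (forall i, 1 < p i) -> 1 <= \sum_(i < n) (p i)^-1 ->
  (forall Q, @dyadic_cubes R d Q -> 0 <= K Q) ->
  (forall i Q, @dyadic_cubes R d Q -> (sigma i Q < +oo)%E) ->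
  0 <= c -> testing_bound K sigma p c ->
  embedding_bound K sigma p (embedding_cst p * c).
Proof.
move=> p1 sum_p K0 sigma_fin c0 test f fL.
pose g i x := `|f i x|.
have gL i : g i \in Lfun (sigma i) (p i)%:E by exact: Lfun_abs.
have Ng i : ('N[sigma i]_((p i)%:E)[EFin \o f i] =
    (fine 'N[sigma i]_((p i)%:E)[EFin \o g i])%:E)%E.
  rewrite fineK ?(Lfun_fin (gL i))//.
  by rewrite -(Lnorm_abse (sigma i) (EFin \o f i)).
under eq_bigr do rewrite Ng.
rewrite prodEFin -EFinM ltry andbT.
apply: ge_ereal_sup => _ [X [finX XD] <-].
have int_on i Q h : dyadic_cubes Q -> h \in Lfun (sigma i) (p i)%:E ->
    (sigma i).-integrable Q (EFin \o h).
  move=> DQ; apply: Lfun_integrable_on; first exact: ltW.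
    exact: dyadic_cubes_measurable.
  exact: sigma_fin.
pose u Q := K Q * \prod_(i < n) \int[sigma i]_(x in Q) g i x.
pose X' := X `&` [set Q | forall i, 0 < \int[sigma i]_(x in Q) g i x].
have X'D Q : X' Q -> dyadic_cubes Q by move=> [/XD].
have finX' : finite_set X' by exact: finite_setIl.
apply: (@le_trans _ _ (\sum_(Q \in X) (u Q)%:E)%E).
  apply: lee_fsum => // Q /XD DQ.
  under eq_bigr => i _ do
    rewrite -(EFin_normr_Rintegral (dyadic_cubes_measurable DQ)
      (int_on _ _ _ DQ (fL i))).
  rewrite prodEFin -EFinM lee_fin ler_wpM2l ?K0//; apply: ler_prod => i _.
  rewrite normr_ge0 /=; apply: le_normr_Rintegral; last exact: int_on.
  exact: dyadic_cubes_measurable.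
rewrite -(fsbig_widen X'); [|by move=> Q []|]; last first.
  move=> Q [XQ nX'] /=; rewrite /u.
  have [i /negP] : exists i, ~ (0 < \int[sigma i]_(x in Q) g i x).
    by apply/existsNP => h; apply: nX'.
  rewrite -leNgt => i0; rewrite (bigD1 i)//= (_ : Rintegral _ _ _ = 0).
    by rewrite mul0r mulr0.
  by apply/eqP; rewrite eq_le i0 Rintegral_ge0// => x _; exact: normr_ge0.
rewrite fsbig_finite// finmap.big_seq_fsetE /= sumEFin lee_fin.
have inX' (q : fset_set X') : X' (val q).
  by have := fsvalP q; rewrite in_fset_set// => /set_mem.
have inD (q : fset_set X') : dyadic_cubes (val q) by exact/X'D/inX'.
apply: (@finite_embedding _ _ R n p p1 sum_p (fset_set X') val).
- by move=> q; exact: (dyadic_cubes_measurable (inD q)).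
- exact: val_inj.
- by move=> q r; exact: (dyadic_cubes_nested (inD q) (inD r)).
- by move=> i q; exact: (sigma_fin i _ (inD q)).
- by move=> q; exact: (K0 _ (inD q)).
- by [].
- exact: gL.
- by move=> i x; exact: normr_ge0.
- by move=> i q; have [_] := inX' q; apply.
move=> j F h hL h0.
have /andP[le_test _] := test j (val F) (inD F) h (fun i _ => hL i).
have DF := inD F.
rewrite -lee_fin.
have RE : ((c * fine (sigma j (val F)) `^ (p j)^-1 *
     \prod_(i < n | i != j) fine 'N[sigma i]_((p i)%:E)[EFin \o h i])%:E =
    c%:E * sigma j (val F) `^ (p j)^-1 *
     \prod_(i < n | i != j) 'N[sigma i]_((p i)%:E)[EFin \o h i])%E.
  rewrite !EFinM -poweR_EFin fineK ?ge0_fin_numE ?sigma_fin//.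
  rewrite -prodEFin; congr (_ * _)%E; apply: eq_bigr => i _.
  by rewrite fineK// (Lfun_fin (hL i)).
rewrite RE; apply: le_trans le_test.
apply: (@sum_fset_le_esum R _ (fset_set X') (fun q => `[< q `<=` val F >]) _
  (fun Q => K Q * fine (sigma j Q) *
    \prod_(i < n | i != j) \int[sigma i]_(x in Q) h i x)).
  move=> Q; rewrite in_fset_set// => /set_mem XQ /asboolP QF.
  by split => //; exact: X'D.
move=> Q; rewrite in_fset_set// => /set_mem XQ _.
have DQ := X'D _ XQ.
rewrite !EFinM fineK ?ge0_fin_numE ?sigma_fin// -prodEFin.
apply: lee_pmul => //.
- by rewrite mule_ge0// lee_fin K0.
- by apply: prode_ge0 => i _; rewrite lee_fin Rintegral_ge0.
rewrite le_eqVlt; apply/orP; left; apply/eqP/eq_bigr => i _.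
rewrite -(EFin_normr_Rintegral (dyadic_cubes_measurable DQ)
  (int_on _ _ _ DQ (hL i))).
by rewrite ger0_norm// Rintegral_ge0.
Qed.

(** The test function is f_j = 1_Q. *)
Lemma testing_of_embedding (R : realType) (d n : nat) (p : 'I_n -> R)
    (K : set (borelRd R d) -> R)
    (sigma : 'I_n -> {measure set (borelRd R d) -> \bar R}) (c : R) :
  (forall i, 1 < p i) ->
  (forall Q, @dyadic_cubes R d Q -> 0 <= K Q) ->
  (forall i Q, @dyadic_cubes R d Q -> (sigma i Q < +oo)%E) ->
  embedding_bound K sigma p c -> testing_bound K sigma p c.
Proof.
move=> p1 K0 sigma_fin emb j Q DQ f fL.
have mQ := dyadic_cubes_measurable DQ.
have pj0 : 0 < p j by rewrite (lt_trans ltr01).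
have [f' f'j f'i] : exists2 f' : 'I_n -> borelRd R d -> R,
    f' j = \1_Q & forall i, i != j -> f' i = f i.
  exists (fun i => if i == j then \1_Q else f i); first by rewrite eqxx.
  by move=> i /negbTE ->.
have N1 := Lnorm_indic (sigma j) pj0 mQ.
have f'L i : f' i \in Lfun (sigma i) (p i)%:E.
  have [->|ij] := eqVneq i j; last by rewrite f'i ?fL.
  rewrite f'j; apply/Lfun_Lnorm_lty; split; first exact: measurable_indic.
  by rewrite N1 poweR_lty// sigma_fin.
have /andP[le_emb fin_emb] := emb f' f'L.
have normE : (c%:E * \prod_(i < n) 'N[sigma i]_((p i)%:E)[EFin \o f' i] =
    c%:E * sigma j Q `^ (p j)^-1 *
    \prod_(i < n | i != j) 'N[sigma i]_((p i)%:E)[EFin \o f i])%E.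
  rewrite (bigD1 j)//= f'j N1 muleA; congr (_ * _)%E.
  by apply: eq_bigr => i /f'i ->.
rewrite -normE fin_emb andbT; apply: le_trans le_emb.
apply: ge_ereal_sup => _ [X [finX XD] <-]; apply: esum_ge; exists X.
  by split => // Q' /XD[].
apply: lee_fsum => // Q' /XD[DQ' Q'Q].
rewrite [X in (_ <= _ * X)%E](bigD1 j)//= f'j muleA.
have -> : (`|\int[sigma j]_(x in Q') (\1_Q x)%:E| = sigma j Q')%E.
  rewrite integral_indic//; last exact: dyadic_cubes_measurable.
  by rewrite setIidr// gee0_abs.
rewrite le_eqVlt; apply/orP; left; apply/eqP; congr (_ * _)%E.
by apply: eq_bigr => i /f'i ->.
Qed.

Lemma least_constant_ge0 (R : realType) (B : R -> Prop) :
  (0 <= least_constant B)%E.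
Proof. by apply: le_ereal_inf_tmp => _ [c [c0 _] <-]; rewrite lee_fin. Qed.

Lemma least_constant_le (R : realType) (B B' : R -> Prop) (C : R) :
  0 < C -> (forall c, 0 <= c -> B c -> B' (C * c)) ->
  (least_constant B' <= C%:E * least_constant B)%E.
Proof.
move=> C0 BB'; rewrite -lee_pdivrMl//.
apply: le_ereal_inf_tmp => _ [c [c0 Bc] <-].
rewrite lee_pdivrMl//; apply: ereal_inf_lbound; exists (C * c) => //.
by split; [rewrite mulr_ge0// ltW|exact: BB'].
Qed.

Unset Implicit Arguments.

Theorem theorem1p3 (R : realType) (d n : nat) (p : 'I_n -> R)
    (p_gt1 : forall i, 1 < p i)
    (sum_p : 1 <= \sum_(i < n) (p i)^-1) :
  exists C : R, 0 < C /\
  forall (K : set (borelRd R d) -> R)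
    (sigma : 'I_n -> {measure set (borelRd R d) -> \bar R}),
    (forall Q, @dyadic_cubes R d Q -> 0 <= K Q) ->
    (forall i Q, @dyadic_cubes R d Q -> (sigma i Q < +oo)%E) ->
  [/\ (exists c1 : R, 0 <= c1 /\ embedding_bound K sigma p c1) <->
      (exists c2 : R, 0 <= c2 /\ testing_bound K sigma p c2),
      (least_constant (embedding_bound K sigma p) <=
       C%:E * least_constant (testing_bound K sigma p))%E
    & (least_constant (testing_bound K sigma p) <=
       C%:E * least_constant (embedding_bound K sigma p))%E].
Proof.
have E0 : 0 <= embedding_cst p.
  rewrite /embedding_cst !mulr_ge0 ?exprn_ge0 ?expR_ge0//.
  by apply: prodr_ge0 => i _; exact: powR_ge0.
have C1 : 1 <= 1 + embedding_cst p by rewrite lerDl.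
have C0 : 0 < 1 + embedding_cst p by exact: lt_le_trans C1.
(* The summand 1 makes the constant large enough for the second comparison,
   in which the two bounds hold with the same constant. *)
exists (1 + embedding_cst p); split => // K sigma K0 sigma_fin.
have ab c : embedding_bound K sigma p c -> testing_bound K sigma p c.
  exact: testing_of_embedding.
have ba c : 0 <= c -> testing_bound K sigma p c ->
    embedding_bound K sigma p ((1 + embedding_cst p) * c).
  move=> c0 /(embedding_of_testing p_gt1 sum_p K0 sigma_fin c0) emb f fL.
  have /andP[h1 h2] := emb f fL.
  have NE : (\prod_(i < n) 'N[sigma i]_((p i)%:E)[EFin \o f i] =
      (\prod_(i < n) fine 'N[sigma i]_((p i)%:E)[EFin \o f i])%:E)%E.
    rewrite -prodEFin; apply: eq_bigr => i _.
    by rewrite fineK// (Lfun_fin (fL i)).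
  rewrite NE -!EFinM ltry andbT in h1 *.
  apply: (le_trans h1); rewrite lee_fin ler_wpM2r//.
    by apply: prodr_ge0 => i _; rewrite fine_ge0// Lnorm_ge0.
  by rewrite ler_wpM2r// lerDr.
split.
- split=> -[c [c0 B]]; first by exists c; split => //; exact: ab.
  exists ((1 + embedding_cst p) * c).
  by split; [rewrite mulr_ge0// ltW|exact: ba].
- exact: least_constant_le.
- apply: (@le_trans _ _ (1%:E * least_constant (embedding_bound K sigma p))%E).
    by apply: least_constant_le => // c _; rewrite mul1r; exact: ab.
  by rewrite lee_wpmul2r ?least_constant_ge0 ?lee_fin.
Qed.
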